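(* Let $L\in C^3(\mathbb{R}^d,\mathbb{R})$ and suppose there are constants $D_1,D_2,D_3,D_4$ with $\sup_{\theta}\|\nabla^jL(\theta)\|\le D_j$ for $j=1,2,3$ and $\|\nabla^3L(\theta_1)-\nabla^3L(\theta_2)\|\le D_4\|\theta_1-\theta_2\|$ for all $\theta_1,\theta_2\in\mathbb{R}^d$ (Euclidean operator norms). Then there exists $h_0>0$ such that for every $h\in(0,h_0)$ there are constants $\gamma,\delta,\lambda>0$ with the following properties: there exists a unique $g_h\in\Gamma_{\gamma,\delta,\lambda}$ satisfying, for all $\theta\in\mathbb{R}^d$, $$-\frac{1}{1-\beta}\nabla L(\zeta_h(\theta))+h\,g_h(\zeta_h(\theta))=-\frac{1}{1-\beta}\nabla L(\theta)+h\beta\,g_h(\theta),\qquad \zeta_h(\theta):=\theta-\frac{h}{1-\beta}\nabla L(\theta)+h^2\beta g_h(\theta),$$ and for every sequence $(\theta^{(n)},v^{(n)})$ generated by full-batch heavy-ball momentum (with arbitrary $\theta^{(0)},v^{(0)}\in\mathbb{R}^d$), $$\Big\|v^{(n)}+\tfrac{1}{1-\beta}\nabla L(\theta^{(n)})-h g_h(\theta^{(n)})\Big\|\le(\beta+h^2\beta\delta)^n\Big\|v^{(0)}+\tfrac{1}{1-\beta}\nabla L(\theta^{(0)})-h g_h(\theta^{(0)})\Big\|\quad\text{for all }n\ge0.$$ In particular $g_h$ is $C^1$ with symmetric Jacobian.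
   Context: Fix $\beta\in(0,1)$ and step size $h>0$. Full-batch heavy-ball momentum (HB) with loss $L:\mathbb{R}^d\to\mathbb{R}$ is the iteration $\theta^{(n+1)}=\theta^{(n)}-h\nabla L(\theta^{(n)})+h\beta v^{(n)}$, $v^{(n+1)}=\beta v^{(n)}-\nabla L(\theta^{(n)})$, $n\ge0$. For constants $\gamma,\delta,\lambda>0$, $\Gamma_{\gamma,\delta,\lambda}$ is the set of $g\in C^1(\mathbb{R}^d,\mathbb{R}^d)$ such that $\sup_\theta\|g(\theta)\|\le\gamma$, $\sup_\theta\|\nabla g(\theta)\|\le\delta$, and the Jacobian $\nabla g$ is symmetric at every point and $\lambda$-Lipschitz (in Euclidean operator norm). *)

(* Defs.v *)
From HB Require Import structures.
From mathcomp Require Import all_boot all_order all_algebra.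
From mathcomp Require Import all_classical all_reals all_analysis.
Set Implicit Arguments. Unset Strict Implicit. Unset Printing Implicit Defensive.
Import Order.TTheory GRing.Theory Num.Theory.
Import numFieldNormedType.Exports.
Local Open Scope ring_scope.

Section Defs.
Variables (R : realType) (d : nat).
Local Notation V := 'rV[R]_d.

Definition ebasis (i : 'I_d) : V := delta_mx 0 i.

Definition norm2 (u : V) : R := Num.sqrt (\sum_i u 0 i ^+ 2).

Definition jac (F : V -> V) (x : V) : 'M[R]_d :=
  \matrix_(i, j) ('d F x (ebasis j)) 0 i.

Definition grad (L : V -> R) (x : V) : V := \row_i ('d L x (ebasis i)).

Definition hess (L : V -> R) (x : V) : 'M[R]_d := jac (grad L) x.

Definition D3 (L : V -> R) (x u v w : V) : R :=
  (u *m ('d (hess L) x w) *m v^T) 0 0.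

Definition C3 (L : V -> R) : Prop :=
  [/\ forall x, differentiable L x,
      forall x, differentiable (grad L) x,
      forall x, differentiable (hess L) x &
      forall w : V, continuous (fun x => 'd (hess L) x w)].

Definition C1 (g : V -> V) : Prop :=
  (forall x, differentiable g x) /\ continuous (jac g).

(* Gamma_{gamma,delta,lambda}; operator-norm bounds ||A|| <= c are written out
   as ||u A|| <= c ||u|| for all u (Euclidean norms). *)
Definition Gamma (gam del lam : R) (g : V -> V) : Prop :=
  [/\ C1 g,
      forall x, norm2 (g x) <= gam,
      forall x u, norm2 (u *m jac g x) <= del * norm2 u,
      forall x, (jac g x)^T = jac g x &
      forall x y u, norm2 (u *m (jac g x - jac g y)) <= lam * norm2 (x - y) * norm2 u].

Definition HB_traj (L : V -> R) (beta h : R) (theta v : nat -> V) : Prop :=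
  forall n, theta n.+1 = theta n - h *: grad L (theta n) + (h * beta) *: v n
         /\ v n.+1 = beta *: v n - grad L (theta n).

Definition zeta (L : V -> R) (beta h : R) (g : V -> V) (x : V) : V :=
  x - (h / (1 - beta)) *: grad L x + (h ^+ 2 * beta) *: g x.

Definition gh_eq (L : V -> R) (beta h : R) (g : V -> V) : Prop :=
  forall x, - (1 - beta)^-1 *: grad L (zeta L beta h g x) + h *: g (zeta L beta h g x)
          = - (1 - beta)^-1 *: grad L x + (h * beta) *: g x.

End Defs.

(* Main.v *)
Require Import Defs.
From HB Require Import structures.
From mathcomp Require Import all_boot all_order all_algebra.
From mathcomp Require Import all_classical all_reals all_analysis.
From mathcomp Require Import ring lra.
Import Order.TTheory GRing.Theory Num.Theory.
Import numFieldNormedType.Exports.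
Local Open Scope ring_scope.
Set Implicit Arguments.
Unset Strict Implicit.
Unset Printing Implicit Defensive.

(* Write [c = (1 - beta)^-1] and [phi = h g - c grad L].  The equation for [g]
   says that the graph [v = phi theta] is invariant under the heavy-ball map.
   Since [theta_(n+1) = theta_n + h v_(n+1)], a point [y] of the graph has
   predecessor [y - h phi y], so [phi] must be a fixed point of
     [phi |-> (y |-> beta phi (y - h phi y) - grad L (y - h phi y))],
   a contraction for the sup norm on [M]-Lipschitz maps when [h M] is small.  It
   also preserves, for [lam] large, the condition
     [|f (x + u) - f x - u A_x| <= lam |u|^2 for some matrix A_x]
   at every [x], which passes to pointwise limits and makes [f] differentiable
   with Lipschitz Jacobian.  Symmetry of the Jacobian [N] follows from the
   conformally symplectic identity [N_y - N_y^T = beta P (N_x - N_x^T) P^T] with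
   [x = y - h phi y] and [P = 1 - h N_y]: the antisymmetric part is shrunk by
   [beta (1 + h M)^2 < 1].  The constant [del] is of order [1 / h], so that
   [h del] dominates the Lipschitz constant [M] of [phi], which governs the rate
   of attraction to the graph. *)

(** * Euclidean inner product and norm of row vectors, and comparison with the sup norm *)

Section EuclideanNorm.
Variables (R : realType) (d : nat).
Local Notation V := 'rV[R]_d.
Implicit Types (u v w : V) (A : 'M[R]_d).

Definition dot u v : R := (u *m v^T) 0 0.

Lemma dotE u v : dot u v = \sum_i u 0 i * v 0 i.
Proof. by rewrite /dot mxE; apply: eq_bigr => i _; rewrite mxE. Qed.

Lemma dotC u v : dot u v = dot v u.
Proof. by rewrite !dotE; apply: eq_bigr => i _; rewrite mulrC. Qed.

Lemma dotDl u v w : dot (u + v) w = dot u w + dot v w.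
Proof. by rewrite /dot mulmxDl mxE. Qed.

Lemma dotNl u w : dot (- u) w = - dot u w.
Proof. by rewrite /dot mulNmx mxE. Qed.

Lemma dotBl u v w : dot (u - v) w = dot u w - dot v w.
Proof. by rewrite dotDl dotNl. Qed.

Lemma dotZl a u w : dot (a *: u) w = a * dot u w.
Proof. by rewrite /dot -scalemxAl mxE. Qed.

Lemma dotDr u v w : dot u (v + w) = dot u v + dot u w.
Proof. by rewrite dotC dotDl !(dotC u). Qed.

Lemma dotBr u v w : dot u (v - w) = dot u v - dot u w.
Proof. by rewrite dotC dotBl !(dotC u). Qed.

Lemma dotZr a u w : dot u (a *: w) = a * dot u w.
Proof. by rewrite dotC dotZl dotC. Qed.

Lemma dot_mulmx u v A : dot (u *m A) v = dot u (v *m A^T).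
Proof. by rewrite /dot trmx_mul trmxK mulmxA. Qed.

Lemma norm2_ge0 u : 0 <= norm2 u.
Proof. exact: sqrtr_ge0. Qed.

Lemma norm2_sqr u : norm2 u ^+ 2 = dot u u.
Proof.
rewrite /norm2 sqr_sqrtr; last by apply: sumr_ge0 => i _; exact: sqr_ge0.
by rewrite dotE; apply: eq_bigr => i _; rewrite expr2.
Qed.

Lemma norm2_le u c : 0 <= c -> dot u u <= c ^+ 2 -> norm2 u <= c.
Proof.
move=> c0; rewrite -norm2_sqr => H.
by rewrite -(@ler_pXn2r _ 2) // nnegrE norm2_ge0.
Qed.

Lemma norm2_0 : norm2 (0 : V) = 0.
Proof.
apply/eqP; rewrite eq_le norm2_ge0 andbT; apply: norm2_le => //.
by rewrite /dot mul0mx mxE expr0n.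
Qed.

Lemma abs_coord_le u i : `|u 0 i| <= norm2 u.
Proof.
rewrite -(@ler_pXn2r _ 2) // ?nnegrE ?norm2_ge0 // real_normK ?num_real //.
rewrite norm2_sqr dotE (bigD1 i) //= expr2 lerDl; apply: sumr_ge0 => j _.
by rewrite -expr2 sqr_ge0.
Qed.

Lemma norm2_eq0 u : norm2 u = 0 -> u = 0.
Proof.
move=> H; apply/rowP => i; rewrite [RHS]mxE; apply/eqP.
by rewrite -normr_le0 -H abs_coord_le.
Qed.

Lemma norm2Z a u : norm2 (a *: u) = `|a| * norm2 u.
Proof.
apply/eqP; rewrite -(@eqrXn2 _ 2) ?mulr_ge0 ?norm2_ge0 //.
by rewrite exprMn !norm2_sqr dotZl dotZr real_normK ?num_real // mulrA expr2.
Qed.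

Lemma norm2N u : norm2 (- u) = norm2 u.
Proof. by rewrite -scaleN1r norm2Z normrN1 mul1r. Qed.

Lemma norm2BC u v : norm2 (u - v) = norm2 (v - u).
Proof. by rewrite -norm2N opprB. Qed.

Lemma dot_le u v : dot u v <= norm2 u * norm2 v.
Proof.
have [u0|u0] := eqVneq (norm2 u) 0.
  by rewrite u0 mul0r (norm2_eq0 u0) /dot mul0mx mxE.
have [v0|v0] := eqVneq (norm2 v) 0.
  by rewrite v0 mulr0 (norm2_eq0 v0) dotC /dot mul0mx mxE.
have up : 0 < norm2 u by rewrite lt_def u0 norm2_ge0.
have vp : 0 < norm2 v by rewrite lt_def v0 norm2_ge0.
have := sqr_ge0 (norm2 (norm2 v *: u - norm2 u *: v)).
rewrite norm2_sqr dotBl !dotBr !dotZl !dotZr (dotC v u) -!norm2_sqr => H.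
by rewrite -(@ler_pM2l _ (norm2 u * norm2 v)) ?mulr_gt0 //; nra.
Qed.

Lemma abs_dot_le u v : `|dot u v| <= norm2 u * norm2 v.
Proof.
rewrite ler_norml dot_le andbT lerNl -dotNl.
by apply: le_trans (dot_le _ _) _; rewrite norm2N.
Qed.

Lemma norm2D u v : norm2 (u + v) <= norm2 u + norm2 v.
Proof.
apply: norm2_le; first by rewrite addr_ge0 ?norm2_ge0.
rewrite dotDl !dotDr (dotC v u) -!norm2_sqr.
by have := dot_le u v; lra.
Qed.

Lemma norm2B u v : norm2 (u - v) <= norm2 u + norm2 v.
Proof. by apply: le_trans (norm2D _ _) _; rewrite norm2N. Qed.

Lemma norm2_triangle w u v : norm2 (u - v) <= norm2 (u - w) + norm2 (w - v).
Proof. by apply: le_trans (norm2D _ _); rewrite addrA subrK. Qed.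

(** Test against [e = u]. This turns vector estimates into scalar ones, to which the mean value
    theorem applies. *)
Lemma norm2_dual u c : 0 <= c ->
  (forall e, dot u e <= c * norm2 e) -> norm2 u <= c.
Proof.
move=> c0 H; have [->//|u0] := eqVneq (norm2 u) 0.
have up : 0 < norm2 u by rewrite lt_def u0 norm2_ge0.
by rewrite -(@ler_pM2r _ (norm2 u)) // -expr2 norm2_sqr.
Qed.

Lemma norm2_sum (I : finType) (f : I -> V) :
  norm2 (\sum_i f i) <= \sum_i norm2 (f i).
Proof.
elim/big_ind2 : _ => //; first by rewrite norm2_0.
by move=> a b c e H1 H2; apply: le_trans (norm2D _ _) (lerD H1 H2).
Qed.

Lemma norm2_ebasis (i : 'I_d) : norm2 (ebasis R i) = 1.
Proof.
apply/eqP; rewrite -(@eqrXn2 _ 2) ?norm2_ge0 // norm2_sqr expr1n dotE.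
rewrite (bigD1 i) //= big1 => [|j ji]; last by rewrite mxE (negbTE ji) mul0r.
by rewrite !mxE !eqxx mulr1 addr0.
Qed.

Lemma norm2_le_sum u : norm2 u <= \sum_i `|u 0 i|.
Proof.
rewrite {1}(row_sum_delta u); apply: le_trans (norm2_sum _) _.
by apply: ler_sum => i _; rewrite norm2Z (norm2_ebasis i) mulr1.
Qed.

Lemma norm2_mulmx_le u A :
  norm2 (u *m A) <= (\sum_i norm2 (row i A)) * norm2 u.
Proof.
rewrite mulmx_sum_row mulr_suml; apply: le_trans (norm2_sum _) _.
apply: ler_sum => i _; rewrite norm2Z mulrC ler_wpM2l ?norm2_ge0 //.
exact: abs_coord_le.
Qed.

Lemma mx_norm_le_norm2 u : `|u| <= norm2 u.
Proof.
rewrite /Num.Def.normr /= mx_normrE; apply/bigmax_leP; split=> [|[i j] _ /=].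
  exact: norm2_ge0.
by rewrite ord1 abs_coord_le.
Qed.

Lemma norm2_le_mx_norm u : norm2 u <= d%:R * `|u|.
Proof.
apply: le_trans (norm2_le_sum _) _.
rewrite -[X in X%:R * _]card_ord -sumr_const mulr_suml.
apply: ler_sum => i _; rewrite mul1r /Num.Def.normr /= mx_normrE.
exact: (le_bigmax _ (fun ij : 'I_1 * 'I_d => `|u ij.1 ij.2|) (0, i)).
Qed.

End EuclideanNorm.

(** * Limits of sequences with geometrically decaying increments *)

Section GeometricSequences.
Variable R : realType.

(** Let [n] tend to infinity. Below, [r ^+ n] is either the error of an iteration or a step length
    shrinking to zero. *)
Lemma le_geometric (a b C r : R) : 0 <= r < 1 ->
  (forall n, a <= b + C * r ^+ n) -> a <= b.
Proof.
move=> /andP[r0 r1] H; rewrite -subr_le0.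
have C0 : (geometric C r @ \oo --> (0 : R))%classic.
  by apply: cvg_geometric; rewrite ger0_norm.
rewrite -(cvg_lim _ C0) //; apply: limr_ge; first by apply/cvg_ex; exists 0.
by near=> n; rewrite lerBlDl; exact: H.
Unshelve. all: by end_near. Qed.

(* [u n - C r^n / (1 - r)] increases and [u n + C r^n / (1 - r)] decreases. *)
Lemma geometric_limit (u : nat -> R) (C r : R) : 0 <= r < 1 ->
  (forall n, `|u n.+1 - u n| <= C * r ^+ n) ->
  {l : R | forall n, `|u n - l| <= C / (1 - r) * r ^+ n}.
Proof.
move=> /andP[r0 r1] H; set C' := C / (1 - r).
have C'E : C = C' * (1 - r) by rewrite /C' divfK // gt_eqF // subr_gt0.
have C0 : 0 <= C.
  by have := le_trans (normr_ge0 _) (H 0%N); rewrite expr0 mulr1.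
have C'0 : 0 <= C' by rewrite divr_ge0 // subr_ge0 ltW.
have rn0 n : 0 <= C' * r ^+ n by rewrite mulr_ge0 // exprn_ge0.
have Hn n : `|u n.+1 - u n| <= C' * r ^+ n - C' * r ^+ n.+1.
  by rewrite exprS; apply: le_trans (H n) _; rewrite C'E; nra.
have nm n m : `|u (n + m)%N - u n| <= C' * r ^+ n - C' * r ^+ (n + m).
  elim: m => [|m IH]; first by rewrite addn0 !subrr normr0.
  rewrite addnS; have := Hn (n + m)%N; move: IH; rewrite !ler_norml; lra.
pose b n := u n - C' * r ^+ n.
have bu n m : b m <= u n + C' * r ^+ n.
  rewrite /b; have [/subnKC <-|/ltnW/subnKC <-] := leqP n m.
    by move: (nm n (m - n)%N) (rn0 (n + (m - n))%N); rewrite ler_norml; lra.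
  by move: (nm m (n - m)%N) (rn0 (m + (n - m))%N); rewrite ler_norml; lra.
exists (sup (range b)) => n; rewrite ler_norml.
have h1 : b n <= sup (range b).
  apply: ub_le_sup; last by exists n.
  by exists (u 0%N + C' * r ^+ 0) => _ [m _ <-]; exact: bu.
have h2 : sup (range b) <= u n + C' * r ^+ n.
  by apply: ge_sup; [exists (b 0%N), 0%N | move=> _ [m _ <-]; exact: bu].
by move: h1; rewrite /b => h1; apply/andP; split; lra.
Qed.

Variable d : nat.
Local Notation V := 'rV[R]_d.

(** Limits are taken coordinatewise, and summing the coordinate errors costs the factor [d]. The
    sigma type lets the limits at all points assemble into a function. *)
Lemma geometric_limit_row (u : nat -> V) (C r : R) : 0 <= r < 1 ->
  (forall n, norm2 (u n.+1 - u n) <= C * r ^+ n) ->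
  {l : V | forall n, norm2 (u n - l) <= d%:R * (C / (1 - r)) * r ^+ n}.
Proof.
move=> r01 H.
have Hi i n : `|u n.+1 0 i - u n 0 i| <= C * r ^+ n.
  apply: le_trans (H n); apply: le_trans (abs_coord_le _ i).
  by rewrite !mxE.
exists (\row_i sval (geometric_limit r01 (Hi i))) => n.
apply: le_trans (norm2_le_sum _) _; rewrite -mulrA.
rewrite -[X in X%:R * _]card_ord -sumr_const mulr_suml.
apply: ler_sum => i _; rewrite mul1r !mxE.
exact: svalP (geometric_limit r01 (Hi i)) n.
Qed.

Lemma lipschitz_fixpoint (f : V -> V) (k : R) : 0 <= k < 1 ->
  (forall x y, norm2 (f x - f y) <= k * norm2 (x - y)) ->
  exists x, f x = x.
Proof.
move=> k01 Hf; have k0 : 0 <= k by case/andP: k01.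
have H n : norm2 (iter n.+1 f 0 - iter n f 0) <= norm2 (f 0 - 0) * k ^+ n.
  elim: n => [|n IH]; first by rewrite expr0 mulr1.
  rewrite iterS [iter n.+1 f 0 in X in _ - X]iterS exprS.
  by apply: le_trans (Hf _ _) _; rewrite mulrCA ler_wpM2l.
have [x Hx] := geometric_limit_row k01 H; exists x.
set C := d%:R * _ in Hx.
apply/eqP; rewrite -subr_eq0; apply/eqP/norm2_eq0/eqP.
rewrite eq_le norm2_ge0 andbT.
(* One [C * k] is the distance from [x] to iterate [n.+1], the other the distance from [f x] to
   it. *)
apply: (@le_geometric _ _ (C * (k + k)) k) => // n; rewrite add0r.
apply: le_trans (norm2_triangle (iter n.+1 f 0) _ _) _.
have := Hx n.+1; have := Hf x (iter n f 0); rewrite -iterS.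
have := ler_wpM2l k0 (Hx n); rewrite (norm2BC x) exprS; lra.
Qed.

End GeometricSequences.

(** * The mean value theorem along a segment *)

Section LineMVT.
Variables (R : realType) (V : normedModType R).

Lemma MVT_line (f : V -> R) (x u : V) : (forall z, differentiable f z) ->
  exists2 c, 0 < c < 1 & f (x + u) - f x = 'd f (x + c *: u) u.
Proof.
move=> df; pose l (t : R) : V := x + t *: u.
have dl (t : R) : is_diff t l ( *:%R^~ u).
  have -> : l = cst x + ( *:%R^~ u : R -> V) by apply/funext.
  by apply: is_diff_eq; rewrite add0r.
have dfl (t : R) : is_derive t (1 : R) (f \o l) ('d f (l t) u).
  apply: DeriveDef; first by apply/derivable1_diffP; apply: differentiable_comp.
  rewrite deriveE; last by apply: differentiable_comp.
  by rewrite diff_comp //= diff_val scale1r.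
have [|c c01] := @MVT R (f \o l) (fun t => 'd f (l t) u) 0 1 ltr01 (fun t _ => dfl t).
  apply: derivable_within_continuous => t _; exact: ex_derive.
rewrite subr0 mulr1 /l /= scale1r scale0r addr0 => H.
by exists c => //; move: c01; rewrite in_itv.
Qed.

Lemma diff_translate (f : V -> R) (a z : V) : differentiable f (z + a) ->
  differentiable (fun y => f (y + a)) z
  /\ 'd (fun y => f (y + a)) z = 'd f (z + a) :> (V -> R).
Proof.
move=> dfz; pose sh (y : V) := y + a.
have dsh : is_diff z sh id.
  have -> : sh = id + cst a by apply/funext.
  by apply: is_diff_eq; rewrite addr0.
have dfs : differentiable (f \o sh) z by exact: differentiable_comp.
by split => //; rewrite (@diff_comp _ _ _ _ sh f) // diff_val.
Qed.

End LineMVT.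

(** * Jacobians, and first-order expansions with quadratic remainder *)

Section MatrixCalculus.
Variable R : realType.

Lemma linear_mx_continuous m n (W : normedModType R)
  (f : {linear 'M[R]_(m, n) -> W}) : continuous f.
Proof.
have -> : f = (fun A => \sum_i \sum_j A i j *: f (delta_mx i j)) :> (_ -> _).
  apply/funext => A; rewrite {1}(matrix_sum_delta A) linear_sum.
  by apply: eq_bigr => i _; rewrite linear_sum; apply: eq_bigr => j _; rewrite linearZ.
apply: continuous_big => [|i _]; first exact: add_continuous.
apply: continuous_big => [|j _ A]; first exact: add_continuous.
by apply: (@cvgZr_tmp _ _ _ (nbhs A)); exact: coord_continuous.
Qed.

Lemma diff_linear_comp (V W : normedModType R) m n
  (F : V -> 'M[R]_(m, n)) (f : {linear 'M[R]_(m, n) -> W}) x :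
  differentiable F x ->
  differentiable (f \o F) x /\ forall u, 'd (f \o F) x u = f ('d F x u).
Proof.
move=> dF; have df : differentiable f (F x).
  exact/linear_differentiable/linear_mx_continuous.
split; first exact: differentiable_comp.
by move=> u; rewrite diff_comp //= diff_lin //; exact: linear_mx_continuous.
Qed.

Variable d : nat.
Local Notation V := 'rV[R]_d.
Implicit Types (x y u v w : V).

(** Registered as linear in [A] for fixed [u] and [v], so that [diff_linear_comp] can differentiate
    a Hessian form. *)
Definition mxform u v (A : 'M[R]_d) : R := dot (u *m A) v.

Fact mxform_is_linear u v : linear (mxform u v).
Proof.
move=> a A B; rewrite /mxform mulmxDr dotDl -scalemxAr dotZl.
by rewrite /GRing.scale.
Qed.

HB.instance Definition _ u v :=
  GRing.isLinear.Build R 'M[R]_d R _ (mxform u v) (mxform_is_linear u v).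

Definition dotr v u : R := dot u v.

Fact dotr_is_linear v : linear (dotr v).
Proof. by move=> a u w; rewrite /dotr dotDl dotZl. Qed.

HB.instance Definition _ v :=
  GRing.isLinear.Build R V R _ (dotr v) (dotr_is_linear v).

(** Row [i] of [jac] belongs to component [i], whereas vectors are rows acted on from the right;
    hence the transpose. *)
Lemma diff_jac (F : V -> V) x u : 'd F x u = u *m (jac F x)^T.
Proof.
rewrite {1}(row_sum_delta u) linear_sum mulmx_sum_row.
apply: eq_bigr => i _; rewrite linearZ; congr (_ *: _).
by apply/rowP => j; rewrite !mxE.
Qed.

Lemma diff_grad (L : V -> R) x u : 'd L x u = dot (grad L x) u.
Proof.
rewrite {1}(row_sum_delta u) linear_sum dotE.
by apply: eq_bigr => i _; rewrite linearZ mxE mulrC.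
Qed.

(** Mean value theorem for the pairing with a test vector [e]. The hypothesis bounds the transpose
    of the differential, so the matrix is moved onto [e]. *)
Lemma jac_bound_lipschitz (F : V -> V) K : 0 <= K ->
  (forall x, differentiable F x) ->
  (forall x u, norm2 (u *m jac F x) <= K * norm2 u) ->
  forall x y, norm2 (F x - F y) <= K * norm2 (x - y).
Proof.
move=> K0 dF HK x y; apply: norm2_dual => [|e]; first by rewrite mulr_ge0 ?norm2_ge0.
have dFe z := diff_linear_comp (dotr e) (dF z).
have [c _] := MVT_line y (x - y) (fun z => (dFe z).1).
rewrite (dFe _).2 subrKC /= /dotr -dotBl => ->.
rewrite diff_jac dot_mulmx trmxK; apply: le_trans (dot_le _ _) _.
by rewrite (mulrC K) -mulrA ler_wpM2l ?norm2_ge0.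
Qed.

(** Holding at every point with one [lam], this expresses a Lipschitz derivative without mentioning
    differentiability. [A] acts from the right, so it is the transposed Jacobian. *)
Definition taylor_at lam (f : V -> V) x (A : 'M[R]_d) :=
  forall u, norm2 (f (x + u) - f x - u *m A) <= lam * norm2 u ^+ 2.

Lemma eq_mx_norm2 (A B : 'M[R]_d) :
  (forall u, norm2 (u *m A - u *m B) <= 0) -> A = B.
Proof.
move=> H; apply/row_matrixP => i; rewrite !rowE.
apply/eqP; rewrite -subr_eq0; apply/eqP/norm2_eq0/eqP.
by rewrite eq_le H norm2_ge0.
Qed.

Let half01 : 0 <= (2^-1 : R) < 1.
Proof. by apply/andP; split; lra. Qed.

(** Along [s *: u] the two linear parts differ by [O(s^2)]; divide by [s = 2^-n]. *)
Lemma taylor_at_unique lam lam' f x A B :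
  taylor_at lam f x A -> taylor_at lam' f x B -> A = B.
Proof.
move=> fA fB; apply: eq_mx_norm2 => u.
apply: (le_geometric half01 (C := (lam + lam') * norm2 u ^+ 2)) => n.
rewrite add0r; set s := _ ^+ n.
have s0 : 0 < s by rewrite exprn_gt0 ?invr_gt0.
rewrite -(ler_pM2l s0) -[X in X * norm2 _](gtr0_norm s0) -norm2Z.
have := fA (s *: u); have := fB (s *: u); rewrite norm2Z gtr0_norm // -!scalemxAl.
set p := f _ - f _ => h1 h2.
have -> : s *: (u *m A - u *m B) = (p - s *: (u *m B)) - (p - s *: (u *m A)).
  by rewrite scalerBr opprB [RHS]addrC addrA subrK.
apply: le_trans (norm2B _ _) _; nra.
Qed.

(** Expand [f (x + u + w)] from [x] directly and through [x + u]. When [norm2 w = norm2 u] the three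
    remainders total [4 + 1 + 1] times [lam * norm2 u ^+ 2]; general [w] follows by rescaling. *)
Lemma taylor_lipschitz lam f (N : V -> 'M[R]_d) :
  (forall x, taylor_at lam f x (N x)) ->
  forall x y w, norm2 (w *m (N x - N y)) <= 6 * lam * norm2 (x - y) * norm2 w.
Proof.
move=> fN.
have key x u w : norm2 w = norm2 u ->
    norm2 (w *m (N (x + u) - N x)) <= 6 * lam * norm2 u ^+ 2.
  move=> wu.
  have h1 := fN (x + u) w; have h2 := fN x (u + w); have h3 := fN x u.
  have -> : w *m (N (x + u) - N x) =
    (f (x + (u + w)) - f x - (u + w) *m N x) - (f (x + u) - f x - u *m N x)
    - (f (x + u + w) - f (x + u) - w *m N (x + u)).
    rewrite mulmxBr mulmxDl addrA; set a := f (x + u + w); set b := f (x + u).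
    by apply/rowP => i; rewrite !mxE; ring.
  apply: le_trans (norm2B _ _) _; apply: le_trans (lerD (norm2B _ _) (lexx _)) _.
  have lam0 : 0 <= lam * norm2 u ^+ 2 by apply: le_trans (norm2_ge0 _) h3.
  (* The sign of [lam] is read off from [lam0], which is possible only when [u] is nonzero. *)
  have h4 : lam * norm2 (u + w) ^+ 2 <= lam * norm2 u ^+ 2 * 4.
    have [u0|u0] := eqVneq (norm2 u) 0.
      have -> : u + w = 0 by rewrite (norm2_eq0 u0) add0r; apply: norm2_eq0; rewrite wu.
      by rewrite u0 norm2_0; lra.
    have lam1 : 0 <= lam by move: lam0; rewrite pmulr_lge0 // exprn_gt0 // lt_def u0 norm2_ge0.
    have := norm2D u w; rewrite wu => h; rewrite -mulrA ler_wpM2l //.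
    by have := norm2_ge0 (u + w); have := norm2_ge0 u; nra.
  by move: h1; rewrite wu; lra.
move=> x y w; rewrite -{1}(subrKC y x); set u := x - y.
have [w0|w0] := eqVneq (norm2 w) 0.
  by rewrite (norm2_eq0 w0) mul0mx norm2_0 mulr0.
have [u0|u0] := eqVneq (norm2 u) 0.
  by rewrite u0 (norm2_eq0 u0) addr0 subrr mulmx0 norm2_0 mulr0 mul0r.
have wp : 0 < norm2 w by rewrite lt_def w0 norm2_ge0.
have up : 0 < norm2 u by rewrite lt_def u0 norm2_ge0.
have ap : 0 < norm2 u / norm2 w by rewrite divr_gt0.
have := key y u ((norm2 u / norm2 w) *: w).
rewrite -scalemxAl !norm2Z gtr0_norm // divfK // => /(_ erefl) H.
rewrite -(ler_pM2l ap); apply: le_trans H _.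
by rewrite le_eqVlt; apply/orP; left; apply/eqP; field.
Qed.

Lemma lipschitz_mx_continuous K (N : V -> 'M[R]_d) :
  (forall x y u, norm2 (u *m (N x - N y)) <= K * norm2 (x - y) * norm2 u) ->
  continuous N.
Proof.
move=> NK x; apply/(@cvgrPdist_le _ _ _ (nbhs x)) => e e0.
(* The factor [d] passes from the Euclidean norm to the sup norm; the absolute value and [+ 1] make
   [K'] positive for any [K]. *)
pose K' := `|K| * d%:R + 1.
have K'0 : 0 < K' by rewrite ltr_wpDl // mulr_ge0.
have eK : 0 < e / K' by rewrite divr_gt0.
apply: filterS (nbhsx_ballx (x : V) _ eK) => y; rewrite -ball_normE /= => xy.
have N0 := norm2_ge0 (x - y); have xy2 := norm2_le_mx_norm (x - y).
rewrite /Num.Def.normr /= mx_normrE; apply/bigmax_leP; split=> [|[i j] _ /=].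
  exact: ltW.
have -> : (N x - N y) i j = (ebasis R i *m (N x - N y)) 0 j.
  by rewrite -rowE [RHS]mxE.
apply: le_trans (abs_coord_le _ _) _; apply: le_trans (NK _ _ _) _.
rewrite norm2_ebasis mulr1; apply: le_trans (ler_wpM2r N0 (ler_norm K)) _.
apply: le_trans (ler_wpM2l (normr_ge0 K) xy2) _; rewrite mulrA.
apply: (@le_trans _ _ (K' * `|x - y|)); first by rewrite ler_wpM2r // /K' lerDl.
by move: xy; rewrite ltr_pdivlMr // mulrC => /ltW.
Qed.

(** A quadratic remainder is [o(u)], and differentials are unique. *)
Lemma taylor_at_diff lam f x A : taylor_at lam f x A ->
  differentiable f x /\ jac f x = A^T.
Proof.
move=> fA; pose dA : {linear V -> V} := mulmxr A.
have cA : continuous dA by exact: linear_mx_continuous.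
have near0 e : 0 < e -> \forall u \near (0 : V),
    `|f (u + x) - (f x + u *m A)| <= e * `|u|.
  move=> e0; pose K := `|lam| * d%:R ^+ 2 + 1.
  have K0 : 0 < K by rewrite ltr_wpDl // mulr_ge0 // sqr_ge0.
  have : \forall u \near (0 : V), `|u| < e / K.
    by apply: (@nbhs0_lt _ V); rewrite divr_gt0.
  apply: filterS => u ue.
  rewrite opprD addrA [u + x]addrC; apply: le_trans (mx_norm_le_norm2 _) _.
  apply: le_trans (fA u) _; have uu := norm2_le_mx_norm u.
  have n0 := norm2_ge0 u; have m0 := normr_ge0 u.
  apply: (@le_trans _ _ (`|lam| * (d%:R * `|u|) ^+ 2)).
    apply: le_trans (ler_wpM2r (sqr_ge0 _) (ler_norm lam)) _.
    by rewrite ler_wpM2l // ler_pXn2r // nnegrE mulr_ge0.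
  rewrite exprMn mulrA expr2 mulrA ler_wpM2r //.
  apply: (@le_trans _ _ (K * `|u|)); first by rewrite ler_wpM2r // /K; lra.
  by move: ue; rewrite ltr_pdivlMr // mulrC => /ltW.
have dfA : 'd f x = dA :> (V -> V).
  by apply: (diff_unique cA); apply/eqaddoP.
split.
  by apply/diff_locallyP; rewrite dfA; split => //; apply/eqaddoP.
by apply/matrixP => i j; rewrite !mxE dfA /= -rowE mxE.
Qed.

End MatrixCalculus.

(** * Expansion of the gradient and symmetry of the Hessian *)

Section HessianFacts.
Variables (R : realType) (d : nat).
Local Notation V := 'rV[R]_d.
Implicit Types (x y u v w : V).

(** Two mean value steps: the increment of the gradient paired with [e] is a Hessian form at some
    [x + c *: u], and comparing this form with its value at [x] brings in [D3]. *)
Lemma grad_taylor (L : V -> R) K : 0 <= K ->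
  (forall x, differentiable (grad L) x) ->
  (forall x, differentiable (hess L) x) ->
  (forall x u v w, `|D3 L x u v w| <= K * norm2 u * norm2 v * norm2 w) ->
  forall x, taylor_at K (grad L) x (hess L x)^T.
Proof.
move=> K0 dG dH HK x u; apply: norm2_dual => [|e].
  by rewrite mulr_ge0 ?sqr_ge0.
have dGe z := diff_linear_comp (dotr e) (dG z).
have [c c01] := MVT_line x u (fun z => (dGe z).1).
rewrite (dGe _).2 /= /dotr -dotBl => E; rewrite dotBl {}E.
have dHe z := diff_linear_comp (mxform e u) (dH z).
have [c' c'01] := MVT_line x (c *: u) (fun z => (dHe z).1).
rewrite (dHe _).2 /= => E.
have trE A B : dot (u *m A^T) e - dot (u *m B^T) e = mxform e u A - mxform e u B.
  by rewrite /mxform 2!(dot_mulmx u) !trmxK !(dotC u).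
rewrite diff_jac (etrans (trE (jac (grad L) (x + c *: u)) (hess L x)) E).
have := HK (x + c' *: (c *: u)) e u (c *: u).
rewrite /D3 -/(dot _ _) /mxform ler_norml => /andP[_] H; apply: le_trans H _.
rewrite norm2Z; case/andP: c01 => c0 c1; rewrite gtr0_norm //.
have e0 := norm2_ge0 e; have u0 := norm2_ge0 u.
have -> : K * norm2 u ^+ 2 * norm2 e = K * norm2 e * norm2 u * norm2 u by ring.
rewrite ler_wpM2l ?mulr_ge0 //; by rewrite ler_piMl // ltW.
Qed.

(** Both values of [G] are expanded at [x], so the terms in [c *: (s *: u)] cancel. The remainders
    are [O(s^2)], and pairing with [s *: u] gives [O(s^3)]. *)
Lemma taylor_at_increment lam G x A u v c s : 0 <= lam -> taylor_at lam G x A ->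
  0 < c < 1 -> 0 < s ->
  `|dot (G (x + c *: (s *: u) + s *: v) - G (x + c *: (s *: u))) (s *: u)
    - s ^+ 2 * dot (v *m A) u| <= 2 * lam * (norm2 u + norm2 v) ^+ 3 * s ^+ 3.
Proof.
move=> lam0 GA /andP[c0 c1] s0; set z := x + c *: (s *: u).
have h1 := GA (c *: (s *: u) + s *: v); have h2 := GA (c *: (s *: u)).
move: h1 h2; rewrite addrA -/z.
set r1 := _ - _ - _; set r2 := _ - _ - _ => h1 h2.
have E : G (z + s *: v) - G z = s *: (v *m A) + (r1 - r2).
  by rewrite /r1 /r2 mulmxDl -!scalemxAl; apply/rowP => i; rewrite !mxE; ring.
rewrite E dotZr dotDl dotZl expr2 mulrDr -mulrA addrAC subrr add0r.
rewrite normrM gtr0_norm //.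
have u0 := norm2_ge0 u; have v0 := norm2_ge0 v.
set m := norm2 u + norm2 v; have m0 : 0 <= m by exact: addr_ge0.
have n2 : norm2 (c *: (s *: u)) <= s * m.
  rewrite !norm2Z !gtr0_norm // mulrCA ler_wpM2l ?(ltW s0) // /m; nra.
have n1 : norm2 (c *: (s *: u) + s *: v) <= s * m.
  apply: le_trans (norm2D _ _) _.
  rewrite !norm2Z !gtr0_norm // mulrCA -mulrDr ler_wpM2l ?(ltW s0) // /m; nra.
have sm0 : 0 <= s * m by rewrite mulr_ge0 // ltW.
have r12 : norm2 (r1 - r2) <= 2 * lam * (s * m) ^+ 2.
  apply: le_trans (norm2B _ _) _.
  have q1 : lam * norm2 (c *: (s *: u) + s *: v) ^+ 2 <= lam * (s * m) ^+ 2.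
    by rewrite ler_wpM2l // ler_pXn2r // nnegrE norm2_ge0.
  have q2 : lam * norm2 (c *: (s *: u)) ^+ 2 <= lam * (s * m) ^+ 2.
    by rewrite ler_wpM2l // ler_pXn2r // nnegrE norm2_ge0.
  lra.
apply: (@le_trans _ _ (s * (2 * lam * (s * m) ^+ 2 * m))).
  rewrite ler_wpM2l ?(ltW s0) //; apply: le_trans (abs_dot_le _ _) _.
  by apply: ler_pM; rewrite ?norm2_ge0 // /m lerDl.
by rewrite le_eqVlt; apply/orP; left; apply/eqP; ring.
Qed.

(* Both orders of expansion of the second difference of [L] along [s u] and
   [s v] agree with [s^2] times the Hessian form up to [O(s^3)]. *)
Lemma grad_taylor_sym (L : V -> R) lam x A : 0 <= lam ->
  (forall x, differentiable L x) -> taylor_at lam (grad L) x A -> A^T = A.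
Proof.
move=> lam0 dL LA.
pose D w1 w2 := L (x + w1 + w2) - L (x + w1) - (L (x + w2) - L x).
have DC w1 w2 : D w1 w2 = D w2 w1.
  rewrite /D (_ : x + w1 + w2 = x + w2 + w1); first lra.
  by rewrite -!addrA [w1 + _]addrC.
have est u v s : 0 < s ->
    `|D (s *: u) (s *: v) - s ^+ 2 * dot (v *m A) u|
    <= 2 * lam * (norm2 u + norm2 v) ^+ 3 * s ^+ 3.
  (* The second difference is the increment of [k] along [s *: u], and the gradient of [k] is an
     increment of [grad L]. *)
  move=> s0; pose k z := L (z + s *: v) - L z.
  have dk z : is_diff z k (fun w => dot (grad L (z + s *: v)) w - dot (grad L z) w).
    have [dLs dLsE] := diff_translate (dL (z + s *: v)).
    have -> : k = (fun y => L (y + s *: v)) - L by apply/funext.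
    apply: DiffDef; first exact: differentiableB.
    rewrite (diffB dLs (dL z)) dLsE; apply/funext => w.
    exact: (congr2 (fun a b => a - b) (diff_grad L _ w) (diff_grad L z w)).
  have dkz z : differentiable k z by case: (dk z).
  have [c c01 kE] := MVT_line x (s *: u) dkz.
  have -> : D (s *: u) (s *: v) =
      dot (grad L (x + c *: (s *: u) + s *: v) - grad L (x + c *: (s *: u))) (s *: u).
    by rewrite dotBl -[LHS]/(k (x + s *: u) - k x) kE diff_val.
  exact: taylor_at_increment lam0 LA c01 s0.
have half01 : 0 <= (2^-1 : R) < 1 by apply/andP; split; lra.
have sym u v : dot (v *m A) u - dot (u *m A) v <= 0.
  (* Each of the two estimates is off by half of [C * s ^+ 3]; division by [s ^+ 2] leaves
     [C * s]. *)
  set C := 2 * (2 * lam * (norm2 u + norm2 v) ^+ 3).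
  apply: (le_geometric half01 (C := C)) => n; rewrite add0r; set s := _ ^+ n.
  have s0 : 0 < s by rewrite exprn_gt0 ?invr_gt0.
  have := est u v s s0; have := est v u s s0; rewrite (DC (s *: v)) [norm2 v + _]addrC.
  rewrite !ler_norml => /andP[a b] /andP[p q].
  rewrite -(ler_pM2l (exprn_gt0 2 s0)) /C; move: a b p q.
  by rewrite (exprSr s 2); lra.
apply: eq_mx_norm2 => u; apply: norm2_dual => // e; rewrite mul0r.
by rewrite dotBl dot_mulmx trmxK (dotC u); exact: sym.
Qed.

End HessianFacts.

(** * Expansions of Lipschitz maps and of limits *)

Section TaylorLimits.
Variables (R : realType) (d : nat).
Local Notation V := 'rV[R]_d.
Implicit Types (x y u v w : V) (f g : V -> V).

Definition lipschitz2 K f := forall x y, norm2 (f x - f y) <= K * norm2 (x - y).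

(** Along [s *: u], the Lipschitz bound and the remainder give
    [K * norm2 u + lam * s * norm2 u ^+ 2] after division by [s]; then [s] tends to zero. *)
Lemma taylor_at_bound lam K f x A : lipschitz2 K f -> taylor_at lam f x A ->
  forall u, norm2 (u *m A) <= K * norm2 u.
Proof.
move=> fK fA u; have half01 : 0 <= (2^-1 : R) < 1 by apply/andP; split; lra.
apply: (le_geometric half01 (C := lam * norm2 u ^+ 2)) => n; set s := _ ^+ n.
have s0 : 0 < s by rewrite exprn_gt0 ?invr_gt0.
have h1 := fA (s *: u); have h2 := fK (x + s *: u) x.
rewrite -(ler_pM2l s0) -[X in X * norm2 (u *m A)](gtr0_norm s0) -norm2Z scalemxAl.
set p := f _ - f _ in h1 h2.
have -> : (s *: u) *m A = p - (p - (s *: u) *m A) by rewrite opprB addrC subrK.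
apply: le_trans (norm2B _ _) _; apply: le_trans (lerD h2 h1) _.
by rewrite [x + _]addrC addrK norm2Z gtr0_norm //; lra.
Qed.

(* Steps of length [r ^ n] turn a [(r ^ n) ^ 2] rate for the functions into an
   [r ^ n] rate for their derivatives. *)
Lemma taylor_at_limit lam C r (fn : nat -> V -> V) f x (A : nat -> 'M[R]_d) :
  0 < r < 1 -> 0 <= lam ->
  (forall n y, norm2 (fn n y - f y) <= C * r ^+ n ^+ 2) ->
  (forall n, taylor_at lam (fn n) x (A n)) -> exists B, taylor_at lam f x B.
Proof.
move=> /andP[r0 r1] lam0 fC fA.
have r01 : 0 <= r < 1 by rewrite ltW.
have rn0 n : 0 < r ^+ n by exact: exprn_gt0.
have C0 : 0 <= C.
  by have := le_trans (norm2_ge0 _) (fC 0%N x); rewrite expr0 expr1n mulr1.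
have stepC n y : norm2 (fn n.+1 y - fn n y) <= 2 * C * r ^+ n ^+ 2.
  apply: le_trans (norm2_triangle (f y) _ _) _.
  rewrite (norm2BC (f y)); have h1 := fC n.+1 y; have h2 := fC n y.
  have : C * r ^+ n.+1 ^+ 2 <= C * r ^+ n ^+ 2.
    rewrite ler_wpM2l // ler_pXn2r ?nnegrE ?(ltW (rn0 _)) //.
    by rewrite exprS ler_piMl // ltW.
  lra.
(* With step [t = r ^+ n], [4 * C] comes from [stepC] at the points [x + e] and [x], and [2 * lam]
   from the two remainders. *)
have rowC i n : norm2 (row i (A n.+1) - row i (A n)) <= (4 * C + 2 * lam) * r ^+ n.
  have t0 := rn0 n; set t := r ^+ n in t0 *; pose e := t *: ebasis R i.
  have ne : norm2 e = t by rewrite /e norm2Z norm2_ebasis gtr0_norm // mulr1.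
  have h1 := fA n.+1 e; have h2 := fA n e.
  have h3 := stepC n (x + e); have h4 := stepC n x.
  rewrite ne in h1 h2; rewrite -/t in h3 h4.
  rewrite -(ler_pM2l t0) -[X in X * norm2 _](gtr0_norm t0) -norm2Z.
  have -> : t *: (row i (A n.+1) - row i (A n)) =
    (fn n.+1 (x + e) - fn n (x + e)) - (fn n.+1 x - fn n x)
    - (fn n.+1 (x + e) - fn n.+1 x - e *m A n.+1)
    + (fn n (x + e) - fn n x - e *m A n).
    rewrite /e -!scalemxAl !rowE; set a := fn _ (x + _); set b := fn n (x + _).
    by apply/rowP => j; rewrite !mxE; ring.
  apply: le_trans (norm2D _ _) _; apply: le_trans (lerD (norm2B _ _) (lexx _)) _.
  apply: le_trans (lerD (lerD (norm2B _ _) (lexx _)) (lexx _)) _; lra.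
have lrow i := geometric_limit_row r01 (rowC i).
pose B : 'M[R]_d := \matrix_i sval (lrow i).
pose C' := d%:R * ((4 * C + 2 * lam) / (1 - r)).
have AB n u : norm2 (u *m A n - u *m B) <= d%:R * C' * norm2 u * r ^+ n.
  rewrite -mulmxBr; apply: le_trans (norm2_mulmx_le _ _) _.
  rewrite mulrAC ler_wpM2r ?norm2_ge0 //.
  rewrite -[X in X%:R * _ * _]card_ord -sumr_const -mulrA mulr_suml.
  apply: ler_sum => i _; rewrite mul1r linearB /= rowK.
  exact: svalP (lrow i) n.
exists B => u.
apply: (le_geometric r01 (C := 2 * C + d%:R * C' * norm2 u)) => n.
have -> : f (x + u) - f x - u *m B =
  (fn n (x + u) - fn n x - u *m A n) - (fn n (x + u) - f (x + u))
  + (fn n x - f x) + (u *m A n - u *m B).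
  set a := fn n (x + u); set b := f (x + u).
  by apply/rowP => j; rewrite !mxE; ring.
apply: le_trans (norm2D _ _) _; apply: le_trans (lerD (norm2D _ _) (lexx _)) _.
apply: le_trans (lerD (lerD (norm2B _ _) (lexx _)) (lexx _)) _.
have h1 := fA n u; have h2 := fC n (x + u); have h3 := fC n x; have h4 := AB n u.
have t0 := rn0 n; have t1 : r ^+ n <= 1 by rewrite exprn_ile1 ?(ltW r0) ?(ltW r1).
have : C * r ^+ n ^+ 2 <= C * r ^+ n.
  by rewrite ler_wpM2l // expr2 ler_piMl // ltW.
rewrite mulrDl; lra.
Qed.

End TaylorLimits.

(** * The graph transform: existence, symmetry, uniqueness and attraction *)

Section InvariantGraph.
Variables (R : realType) (d : nat).
Local Notation V := 'rV[R]_d.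
Variables (F : V -> V) (NF : V -> 'M[R]_d) (b h d1 d2 lamF M : R).
Hypotheses (b01 : 0 < b < 1) (h0 : 0 < h) (d2_ge0 : 0 <= d2) (lamF_ge0 : 0 <= lamF).
Hypothesis F_bound : forall x, norm2 (F x) <= d1.
Hypothesis F_lip : lipschitz2 d2 F.
Hypothesis F_taylor : forall x, taylor_at lamF F x (NF x).
Hypothesis NF_sym : forall x, (NF x)^T = NF x.
Hypothesis M_gt0 : 0 < M.
Hypothesis d2_le : 2 * d2 <= (1 - b) * M.
Hypothesis hM_lt : 8 * (h * M) < 1 - b.

Implicit Types (x y u v w : V) (phi psi : V -> V).

(* The graph [v = phi theta] is invariant iff
   [phi y = b phi (theta) - F (theta)] whenever [y = theta + h phi y]; this is
   the fixed point equation of [graph_step], in which no inverse map occurs. *)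
Definition kick phi x := b *: phi x - F x.
Definition graph_step phi y := kick phi (y - h *: phi y).

(** [B] solves [B = b * B + d1], so the transform preserves this sup bound; [k] is its contraction
    factor. *)
Let B := d1 / (1 - b).
Let k := b + h * (b * M + d2).

Let b0 : 0 < b. Proof. by case/andP: b01. Qed.
Let b1 : b < 1. Proof. by case/andP: b01. Qed.
Let hM0 : 0 < h * M. Proof. exact: mulr_gt0. Qed.
Let bMd2 : 0 <= b * M + d2. Proof. by rewrite addr_ge0 // mulr_ge0 ?(ltW b0) ?(ltW M_gt0). Qed.
Let bMd2_le : b * M + d2 <= M.
Proof. by have := d2_le; have := d2_ge0; lra. Qed.
Let hb_le : h * (b * M + d2) <= h * M.
Proof. by rewrite ler_wpM2l // ltW. Qed.
Let hb_ge0 : 0 <= h * (b * M + d2).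
Proof. by rewrite mulr_ge0 // ltW. Qed.
Let k_ge0 : 0 <= k. Proof. by rewrite /k addr_ge0 // ltW. Qed.
Let k_lt1 : k < 1. Proof. by rewrite /k; move: hb_le hM_lt hM0 b1; lra. Qed.

Lemma kick_lip K phi : lipschitz2 K phi -> lipschitz2 (b * K + d2) (kick phi).
Proof.
move=> Hphi x y; rewrite /kick.
have -> : b *: phi x - F x - (b *: phi y - F y) = b *: (phi x - phi y) - (F x - F y).
  by apply/rowP => i; rewrite !mxE; ring.
apply: le_trans (norm2B _ _) _; rewrite norm2Z gtr0_norm // mulrDl -mulrA.
by apply: lerD; [rewrite ler_wpM2l // ltW | exact: F_lip].
Qed.

Lemma graph_step_bound phi :
  (forall x, norm2 (phi x) <= B) -> forall y, norm2 (graph_step phi y) <= B.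
Proof.
move=> Hphi y; apply: le_trans (norm2B _ _) _; rewrite norm2Z gtr0_norm //.
apply: le_trans (lerD (ler_wpM2l (ltW b0) (Hphi _)) (F_bound _)) _.
have -> : d1 = (1 - b) * B by rewrite /B mulrC divfK // gt_eqF // subr_gt0.
lra.
Qed.

Let shift_lip phi y u : lipschitz2 M phi ->
  norm2 (u - h *: (phi (y + u) - phi y)) <= (1 + h * M) * norm2 u.
Proof.
move=> Hphi; apply: le_trans (norm2B _ _) _.
rewrite norm2Z gtr0_norm // mulrDl mul1r lerD2l -mulrA ler_wpM2l ?(ltW h0) //.
by have := Hphi (y + u) y; rewrite [y + u]addrC addrK.
Qed.

Let shiftE phi y u :
  y + u - h *: phi (y + u) = y - h *: phi y + (u - h *: (phi (y + u) - phi y)).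
Proof. by set a := phi (y + u); apply/rowP => i; rewrite !mxE; ring. Qed.

(** By [d2_le], [b * M + d2] is at most halfway between [b * M] and [M]; the factor [1 + h * M] from
    the shifted argument fits into the remaining gap by [hM_lt]. *)
Lemma graph_step_lip phi : lipschitz2 M phi -> lipschitz2 M (graph_step phi).
Proof.
move=> Hphi x y; rewrite /graph_step -{1 2}(subrKC y x); set u := x - y.
apply: le_trans (kick_lip Hphi _ _) _; rewrite shiftE addrAC subrr add0r.
apply: le_trans (ler_wpM2l bMd2 (shift_lip _ _ Hphi)) _.
rewrite mulrA ler_wpM2r ?norm2_ge0 //.
apply: (@le_trans _ _ ((b * M + d2) + M * (h * M))).
  by rewrite mulrDr mulr1 lerD2l ler_wpM2r // ltW.
have : M * (8 * (h * M)) <= M * (1 - b) by rewrite ler_wpM2l // ltW.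
by have := d2_le; have := M_gt0; have := b1; nra.
Qed.

(** The two base points differ by at most [h * E], and inserting [kick phi x'] charges this shift to
    the Lipschitz constant of [phi]. In the uniqueness proof [psi] has a different constant. *)
Lemma graph_step_contract phi psi E : lipschitz2 M phi ->
  (forall x, norm2 (phi x - psi x) <= E) ->
  forall y, norm2 (graph_step phi y - graph_step psi y) <= k * E.
Proof.
move=> Hphi HE y; rewrite /graph_step; set x := y - _; set x' := y - _.
apply: le_trans (norm2_triangle (kick phi x') _ _) _.
rewrite /k mulrDl [leRHS]addrC; apply: lerD.
  apply: le_trans (kick_lip Hphi _ _) _.
  have -> : x - x' = h *: (psi y - phi y).
    by apply/rowP => i; rewrite !mxE; ring.
  rewrite norm2Z gtr0_norm // norm2BC mulrA [_ * h]mulrC.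
  by rewrite ler_wpM2l.
rewrite /kick opprB addrA subrK -scalerBr norm2Z gtr0_norm //.
by rewrite ler_wpM2l // ltW.
Qed.

(** Chain rule in row convention, inner derivative on the left. The condition on [lam] makes the
    same remainder constant reproduce itself. *)
Lemma graph_step_taylor lam phi N y : 8 * lamF <= (1 - b) * lam ->
  lipschitz2 M phi -> (forall x, taylor_at lam phi x (N x)) ->
  taylor_at lam (graph_step phi) y
    ((1%:M - h *: N y) *m (b *: N (y - h *: phi y) - NF (y - h *: phi y))).
Proof.
move=> lam_ge Hphi HN u; set x := y - _; set A := _ - NF x.
have lam0 : 0 <= lam.
  by rewrite -(pmulr_rge0 _ (_ : 0 < 1 - b)) ?subr_gt0 //; apply: le_trans lam_ge; rewrite mulr_ge0.
have WA : taylor_at (b * lam + lamF) (kick phi) x A.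
  move=> p; rewrite /kick /A.
  have -> : b *: phi (x + p) - F (x + p) - (b *: phi x - F x) - p *m (b *: N x - NF x)
    = b *: (phi (x + p) - phi x - p *m N x) - (F (x + p) - F x - p *m NF x).
    rewrite mulmxBr -scalemxAr; set a := phi (x + p); set c := F (x + p).
    by apply/rowP => i; rewrite !mxE; ring.
  apply: le_trans (norm2B _ _) _; rewrite norm2Z gtr0_norm // mulrDl -mulrA.
  apply: lerD; last exact: F_taylor.
  by rewrite ler_wpM2l ?(ltW b0) //; exact: HN.
have Abound := taylor_at_bound (kick_lip Hphi) WA.
set p := u - h *: (phi (y + u) - phi y).
have pE : norm2 p <= (1 + h * M) * norm2 u by exact: shift_lip.
(* The error splits into that of [kick phi] along the true displacement [p] and that of [phi]
   carried through [A]. *)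
have -> : graph_step phi (y + u) - graph_step phi y
    - u *m ((1%:M - h *: N y) *m A)
  = (kick phi (x + p) - kick phi x - p *m A)
    - h *: ((phi (y + u) - phi y - u *m N y) *m A).
  rewrite /graph_step shiftE -/p -/x mulmxA [u *m (1%:M - _)]mulmxBr mulmx1 -scalemxAr /p.
  move: (A) => A'.
  rewrite !mulmxBl -!scalemxAl mulmxBl.
  set a := kick phi _; set c := kick phi x; set e := phi (y + u).
  by apply/rowP => i; rewrite !mxE; ring.
apply: le_trans (norm2B _ _) _; rewrite norm2Z gtr0_norm //.
have h1 := WA p; have h2 := Abound (phi (y + u) - phi y - u *m N y).
have h3 := HN y u; have u0 := norm2_ge0 u; have p0 := norm2_ge0 p.
set q := norm2 u ^+ 2 in h3 *; have q0 : 0 <= q by exact: sqr_ge0.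
have pq : norm2 p ^+ 2 <= (1 + 3 * (h * M)) * q.
  apply: (@le_trans _ _ (((1 + h * M) * norm2 u) ^+ 2)).
    by rewrite ler_pXn2r // nnegrE // mulr_ge0 // addr_ge0 // ltW.
  rewrite exprMn ler_wpM2r //; have := hM0; have := hM_lt; have := b0; nra.
have h4 : (b * lam + lamF) * norm2 p ^+ 2 <= (b * lam + lamF) * ((1 + 3 * (h * M)) * q).
  by rewrite ler_wpM2l // addr_ge0 // mulr_ge0 // ltW.
have h5 : h * norm2 ((phi (y + u) - phi y - u *m N y) *m A) <= h * M * (lam * q).
  apply: le_trans (ler_wpM2l (ltW h0) h2) _; rewrite mulrA.
  apply: le_trans (ler_wpM2l hb_ge0 h3) _.
  by rewrite ler_wpM2r // mulr_ge0.
apply: le_trans (lerD (le_trans h1 h4) h5) _.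
have s1 : lam * (8 * (h * M)) <= lam * (1 - b) by rewrite ler_wpM2l // ltW.
have s2 : b * (lam * (h * M)) <= lam * (h * M).
  by rewrite ler_piMl ?(ltW b1) // mulr_ge0 // ltW.
have s3 : lamF * (8 * (h * M)) <= lamF * 1.
  by rewrite ler_wpM2l //; have := hM_lt; have := b0; lra.
(* Beyond [b * lam], every term is a small multiple of [(1 - b) * lam], by [lam_ge] and [hM_lt]. *)
have main : (b * lam + lamF) * (1 + 3 * (h * M)) + h * M * lam <= lam.
  by move: lam_ge lamF_ge0; lra.
by have := ler_wpM2r q0 main; lra.
Qed.

Let phin n := iter n graph_step (fun=> 0).

Let B_ge0 : 0 <= B.
Proof.
rewrite divr_ge0 ?subr_ge0 ?(ltW b1) //.
exact: le_trans (norm2_ge0 _) (F_bound 0).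
Qed.

Let phin_bound n x : norm2 (phin n x) <= B.
Proof.
by elim: n x => [|n IH] x; [rewrite norm2_0 | exact: graph_step_bound].
Qed.

Let phin_lip n : lipschitz2 M (phin n).
Proof.
elim: n => [|n IH]; last exact: graph_step_lip.
by move=> x y; rewrite subrr norm2_0 mulr_ge0 ?norm2_ge0 // ltW.
Qed.

Let phin_taylor lam n : 8 * lamF <= (1 - b) * lam ->
  exists N, forall x, taylor_at lam (phin n) x (N x).
Proof.
move=> lam_ge; elim: n => [|n [N IH]]; last first.
  by eexists => x; exact: (graph_step_taylor _ lam_ge (phin_lip n) IH).
exists (fun=> 0) => x u; rewrite mulmx0 !subr0 norm2_0 mulr_ge0 ?sqr_ge0 //.
rewrite -(pmulr_rge0 _ (_ : 0 < 1 - b)) ?subr_gt0 //.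
by apply: le_trans lam_ge; rewrite mulr_ge0.
Qed.

Let phin_diff n x : norm2 (phin n.+1 x - phin n x) <= B * k ^+ n.
Proof.
elim: n x => [|n IH] x; first by rewrite subr0 expr0 mulr1; exact: (phin_bound 1).
rewrite exprS mulrCA.
exact: (graph_step_contract (phin_lip n.+1) IH).
Qed.

Let k01 : 0 <= k < 1. Proof. by rewrite k_ge0. Qed.

Let limit_lip phi C : (forall n x, norm2 (phin n x - phi x) <= C * k ^+ n) ->
  lipschitz2 M phi.
Proof.
move=> HC x y; apply: (le_geometric k01 (C := 2 * C)) => n.
apply: le_trans (norm2_triangle (phin n x) _ _) _.
apply: le_trans (lerD (lexx _) (norm2_triangle (phin n y) _ _)) _.
rewrite (norm2BC (phi x)); have := HC n x; have := HC n y.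
have := phin_lip n x y; lra.
Qed.

Let limit_bound phi C : (forall n x, norm2 (phin n x - phi x) <= C * k ^+ n) ->
  forall x, norm2 (phi x) <= B.
Proof.
move=> HC x; apply: (le_geometric k01 (C := C)) => n.
rewrite -[phi x](subKr (phin n x)); apply: le_trans (norm2B _ _) _.
by apply: lerD.
Qed.

Let limit_fixed phi C : (forall n x, norm2 (phin n x - phi x) <= C * k ^+ n) ->
  phi = graph_step phi.
Proof.
move=> HC; apply/funext => y; apply/eqP; rewrite -subr_eq0.
apply/eqP/norm2_eq0/eqP; rewrite eq_le norm2_ge0 andbT.
apply: (le_geometric k01 (C := 2 * C * k)) => n; rewrite add0r.
apply: le_trans (norm2_triangle (phin n.+1 y) _ _) _.
have h1 := graph_step_contract (phin_lip n) (HC n) y.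
rewrite (norm2BC (phi y)); have := HC n.+1 y; rewrite exprS.
move: h1; rewrite -[graph_step (phin n) y]/(phin n.+1 y); lra.
Qed.

(* With [P = 1 - h N(y)] and [A = b N(x) - NF(x)], the identity [N(y) = P A]
   says [P (1 + h A) = 1], whence [N(y) - N(y)^T = P (A - A^T) P^T]. *)
Let fixed_sym lam phi N : 8 * lamF <= (1 - b) * lam ->
  phi = graph_step phi -> lipschitz2 M phi ->
  (forall x, taylor_at lam phi x (N x)) -> forall x, (N x)^T = N x.
Proof.
move=> lam_ge fixE Hphi HN.
pose S x := N x - (N x)^T.
have rec y : S y = b *: ((1%:M - h *: N y) *m S (y - h *: phi y) *m (1%:M - h *: N y)^T).
  have := graph_step_taylor y lam_ge Hphi HN; rewrite -fixE => /(taylor_at_unique (HN y)).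
  set x := y - _; set P := _ - h *: N y; set A := _ - NF x => NE.
  have SA : A - A^T = b *: S x.
    rewrite /A /S linearB linearZ /= NF_sym scalerBr opprB addrA subrK.
    by [].
  have PI : P + h *: (P *m A) = 1%:M by rewrite -NE /P subrK.
  have PIt : P^T + h *: (A^T *m P^T) = 1%:M.
    by have := congr1 trmx PI; rewrite linearD linearZ /= trmx_mul trmx1.
  have PN : P^T - P = h *: S y.
    rewrite /P /S linearB linearZ /= trmx1 scalerBr.
    by apply/matrixP => i j; rewrite !mxE; ring.
  have hS : h *: S y = h *: (b *: (P *m S x *m P^T)).
    rewrite -PN (scalemxAl b) (scalemxAr b) -SA mulmxBr mulmxBl scalerBr.
    have -> : h *: (P *m A *m P^T) = P^T - P *m P^T.
      by apply/eqP; rewrite eq_sym subr_eq addrC scalemxAl -mulmxDl PI mul1mx.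
    have -> : h *: (P *m A^T *m P^T) = P - P *m P^T.
      apply/eqP; rewrite eq_sym subr_eq addrC -mulmxA scalemxAr -mulmxDr PIt.
      by rewrite mulmx1.
    by rewrite [X in _ = _ - X]addrC addrKA.
  by apply: scalerI hS; rewrite gt_eqF.
have Nbound x u := taylor_at_bound Hphi (HN x) u.
set r := b * (1 + h * M) ^+ 2.
have hM1 : 0 <= 1 + h * M by rewrite addr_ge0 // ltW.
have r01 : 0 <= r < 1.
  rewrite /r mulr_ge0 ?sqr_ge0 ?(ltW b0) //=.
  have e0 := hM0; have e1 := hM_lt; move: (h * M) e0 e1 => e e0 e1.
  have sq : (1 + e) ^+ 2 <= 1 + (1 - b) / 2 by move: b0; nra.
  by have := ler_wpM2l (ltW b0) sq; move: b0 b1; nra.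
have Pbound y u : norm2 (u *m (1%:M - h *: N y)) <= (1 + h * M) * norm2 u.
  rewrite mulmxBr mulmx1 -scalemxAr; apply: le_trans (norm2B _ _) _.
  rewrite norm2Z gtr0_norm // mulrDl mul1r lerD2l -mulrA.
  by rewrite ler_wpM2l // ltW.
(* Stated for all [y], since [rec] moves to the predecessor of [y]. Each factor [1 - h N] is
   absorbed by a test vector at cost [1 + h * M]. *)
have Sn n y u v : `|dot (u *m S y) v| <= 2 * M * norm2 u * norm2 v * r ^+ n.
  elim: n y u v => [|n IH] y u v.
    rewrite expr0 mulr1 /S mulmxBr dotBl [dot (u *m (N y)^T) v]dot_mulmx trmxK.
    apply: le_trans (ler_normB _ _) _.
    have := abs_dot_le (u *m N y) v; have := abs_dot_le u (v *m N y).
    have := ler_wpM2r (norm2_ge0 v) (Nbound y u).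
    have := ler_wpM2l (norm2_ge0 u) (Nbound y v); lra.
  rewrite rec -scalemxAr dotZl normrM gtr0_norm // mulmxA dot_mulmx trmxK mulmxA.
  apply: le_trans (ler_wpM2l (ltW b0) (IH _ _ _)) _.
  have M2 : 0 <= 2 * M by rewrite mulr_ge0 // ltW.
  have rn : 0 <= r ^+ n by rewrite exprn_ge0 //; case/andP: r01.
  have -> : 2 * M * norm2 u * norm2 v * r ^+ n.+1
    = b * (2 * M * ((1 + h * M) * norm2 u) * ((1 + h * M) * norm2 v) * r ^+ n).
    by rewrite exprS /r; ring.
  rewrite ler_wpM2l ?(ltW b0) // ler_wpM2r //.
  apply: ler_pM; rewrite ?mulr_ge0 ?norm2_ge0 ?(ltW M_gt0) //.
  by rewrite ler_wpM2l.
move=> x; apply: eq_mx_norm2 => u; apply: norm2_dual => // e; rewrite mul0r.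
apply: (le_geometric r01 (C := 2 * M * norm2 u * norm2 e)) => n; rewrite add0r.
have := Sn n x u e; rewrite /S mulmxBr dotBl dotBl ler_norml; lra.
Qed.

Theorem invariant_graph lam : 8 * lamF <= (1 - b) * lam ->
  exists phi N, [/\ phi = graph_step phi, lipschitz2 M phi,
    forall x, norm2 (phi x) <= B, forall x, taylor_at lam phi x (N x)
    & forall x, (N x)^T = N x].
Proof.
move=> lam_ge.
have lim x := geometric_limit_row k01 (fun n => phin_diff n x).
pose phi x := sval (lim x).
have HC n x : norm2 (phin n x - phi x) <= d%:R * (B / (1 - k)) * k ^+ n.
  exact: svalP (lim x) n.
set C := d%:R * _ in HC.
have C0 : 0 <= C by rewrite mulr_ge0 // divr_ge0 // subr_ge0 ltW.
have lam0 : 0 <= lam.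
  by rewrite -(pmulr_rge0 _ (_ : 0 < 1 - b)) ?subr_gt0 //; apply: le_trans lam_ge; rewrite mulr_ge0.
have phiN x : exists A, taylor_at lam phi x A.
  have tn n : exists A, taylor_at lam (phin n) x A.
    by have [N HN] := phin_taylor n lam_ge; exists (N x).
  have [A HA] := choice tn.
  (* The required rate is the square of a geometric one; [k <= ((1 + k) / 2) ^+ 2] because
     [(1 - k) ^+ 2 >= 0]. *)
  apply: (@taylor_at_limit _ _ lam C ((1 + k) / 2) phin phi x A) => //.
    by have := k_ge0; have := k_lt1; move=> ? ?; apply/andP; split; lra.
  move=> n y; apply: le_trans (HC n y) _; rewrite ler_wpM2l //.
  rewrite -exprM mulnC exprM lerXn2r ?nnegrE ?sqr_ge0 //.
  by have := sqr_ge0 (1 - k); nra.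
have [N HN] := choice phiN.
have fixE := limit_fixed HC; have Hphi := limit_lip HC.
exists phi, N; split => //; first exact: limit_bound HC.
exact: fixed_sym lam_ge fixE Hphi HN.
Qed.

(** Since [h * M < 1], the equation [y = x + h *: phi y] has a solution; its predecessor is [x], and
    the backward equation at [y] becomes the forward one at [x]. *)
Lemma graph_step_forward phi : phi = graph_step phi -> lipschitz2 M phi ->
  forall x, phi (x + h *: kick phi x) = kick phi x.
Proof.
move=> fixE Hphi x.
have [||y yE] := @lipschitz_fixpoint R d (fun y => x + h *: phi y) (h * M).
- by rewrite (ltW hM0) /=; have := hM_lt; have := b0; have := hM0; lra.
- move=> y z; rewrite opprD addrACA subrr add0r -scalerBr norm2Z gtr0_norm //.
  by rewrite -mulrA ler_wpM2l // ltW.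
have xE : y - h *: phi y = x by rewrite -{1}yE addrK.
have phiy : phi y = kick phi x by rewrite {1}fixE /graph_step xE.
by rewrite -phiy yE.
Qed.

(** The bound on [h * (b * K + d2)] makes [x + h *: kick psi x] surjective in [x], so forward
    invariance yields the fixed point equation; then [graph_step] contracts the difference. [K] is
    allowed to exceed [M]. *)
Lemma invariant_graph_unique phi psi K C : phi = graph_step phi ->
  lipschitz2 M phi -> (forall x, norm2 (phi x) <= C) ->
  0 <= K -> h * (b * K + d2) < 1 -> lipschitz2 K psi ->
  (forall x, norm2 (psi x) <= C) ->
  (forall x, psi (x + h *: kick psi x) = kick psi x) -> psi = phi.
Proof.
move=> fixE Hphi phiC K0 hK Hpsi psiC psiE.
have psi_fix : psi = graph_step psi.
  apply/funext => y; rewrite /graph_step.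
  have [||x xE] := @lipschitz_fixpoint R d (fun x => y - h *: kick psi x) (h * (b * K + d2)).
  - by rewrite hK andbT mulr_ge0 ?(ltW h0) // addr_ge0 // mulr_ge0 // ltW.
  - move=> x z; have -> : y - h *: kick psi x - (y - h *: kick psi z) =
        h *: (kick psi z - kick psi x).
      by move: (kick psi x) (kick psi z) => a c; apply/rowP => i; rewrite !mxE; ring.
    rewrite norm2Z gtr0_norm // -mulrA ler_wpM2l ?(ltW h0) // norm2BC.
    exact: kick_lip.
  have yE : x + h *: kick psi x = y by rewrite -{1}xE subrK.
  have psiy : psi y = kick psi x by rewrite -{1}yE psiE.
  by rewrite psiy xE.
have H n x : norm2 (phi x - psi x) <= 2 * C * k ^+ n.
  elim: n x => [|n IH] x.
    rewrite expr0 mulr1; apply: le_trans (norm2B _ _) _.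
    by have := phiC x; have := psiC x; lra.
  rewrite exprS mulrCA fixE psi_fix.
  exact: graph_step_contract Hphi IH x.
apply/funext => x; apply/eqP; rewrite eq_sym -subr_eq0.
apply/eqP/norm2_eq0/eqP; rewrite eq_le norm2_ge0 andbT.
by apply: (le_geometric k01 (C := 2 * C)) => n; rewrite add0r.
Qed.

(** With [e] the offset from the graph, the new velocity is [kick phi] plus [b *: e], and the new
    position is off its on-graph value by [(h * b) *: e], which [phi] magnifies by at most [K]. *)
Lemma invariant_graph_attracts phi K (theta v : nat -> V) : 0 <= K ->
  lipschitz2 K phi -> (forall x, phi (x + h *: kick phi x) = kick phi x) ->
  (forall n, theta n.+1 = theta n - h *: F (theta n) + (h * b) *: v n
          /\ v n.+1 = b *: v n - F (theta n)) ->
  forall n, norm2 (v n - phi (theta n))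
    <= (b + h * b * K) ^+ n * norm2 (v 0%N - phi (theta 0%N)).
Proof.
move=> K0 Hphi phiE traj; elim=> [|n IH]; first by rewrite expr0 mul1r.
have [thE vE] := traj n.
set e := v n - phi (theta n) in IH.
have thE' : theta n.+1 = theta n + h *: kick phi (theta n) + (h * b) *: e.
  by rewrite thE /e /kick; apply/rowP => i; rewrite !mxE; ring.
have -> : v n.+1 - phi (theta n.+1) =
    b *: e - (phi (theta n.+1) - phi (theta n + h *: kick phi (theta n))).
  by rewrite phiE vE /e /kick; apply/rowP => i; rewrite !mxE; ring.
apply: le_trans (norm2B _ _) _.
apply: le_trans (lerD (lexx _) (Hphi _ _)) _.
rewrite {1}thE' [X in norm2 (X - _)]addrC addrK !norm2Z !gtr0_norm ?mulr_gt0 //.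
rewrite exprS -mulrA.
have -> : b * norm2 e + K * (h * b * norm2 e) = (b + h * b * K) * norm2 e by ring.
by rewrite ler_wpM2l // addr_ge0 ?mulr_ge0 // ltW.
Qed.

End InvariantGraph.

(** * Change of unknown between the correction [g] and the graph [phi] *)

Section VelocityGraph.
Variables (R : realType) (d : nat).
Local Notation V := 'rV[R]_d.
Variables (F : V -> V) (b h : R).
Hypotheses (b_lt1 : b < 1) (h_gt0 : 0 < h).
Implicit Types (g phi : V -> V).

Definition velocity g x : V := h *: g x - (1 - b)^-1 *: F x.
Definition correction phi x : V := h^-1 *: (phi x + (1 - b)^-1 *: F x).

Let h_neq0 : h != 0. Proof. by rewrite gt_eqF. Qed.
Let b_neq1 : 1 - b != 0. Proof. by rewrite gt_eqF // subr_gt0. Qed.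
Let c_ge0 : 0 <= (1 - b)^-1. Proof. by rewrite invr_ge0 subr_ge0 ltW. Qed.

Lemma correctionK phi : velocity (correction phi) = phi.
Proof.
apply/funext => x; rewrite /velocity /correction scalerA divff // scale1r.
by rewrite addrK.
Qed.

Lemma velocityK g : correction (velocity g) = g.
Proof.
apply/funext => x; rewrite /velocity /correction subrK scalerA mulVf //.
by rewrite scale1r.
Qed.

Lemma velocity_kick g x :
  kick F b (velocity g) x = - (1 - b)^-1 *: F x + (h * b) *: g x.
Proof. by rewrite /kick /velocity; apply/rowP => i; rewrite !mxE; field. Qed.

Lemma velocity_zeta g x : x + h *: kick F b (velocity g) x =
  x - (h / (1 - b)) *: F x + (h ^+ 2 * b) *: g x.
Proof. by rewrite velocity_kick; apply/rowP => i; rewrite !mxE; ring. Qed.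

Lemma velocity_lip K K' g : lipschitz2 K F -> lipschitz2 K' g ->
  lipschitz2 (h * K' + K / (1 - b)) (velocity g).
Proof.
move=> FK gK x y; rewrite /velocity.
have -> : h *: g x - (1 - b)^-1 *: F x - (h *: g y - (1 - b)^-1 *: F y) =
    h *: (g x - g y) - (1 - b)^-1 *: (F x - F y).
  by apply/rowP => i; rewrite !mxE; ring.
apply: le_trans (norm2B _ _) _; rewrite !norm2Z (gtr0_norm h_gt0) ger0_norm //.
rewrite mulrDl -mulrA [K / _]mulrC -mulrA.
by apply: lerD; rewrite ler_wpM2l // ltW.
Qed.

Lemma velocity_bound K K' g x : norm2 (F x) <= K -> norm2 (g x) <= K' ->
  norm2 (velocity g x) <= h * K' + K / (1 - b).
Proof.
move=> FK gK; apply: le_trans (norm2B _ _) _.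
rewrite !norm2Z (gtr0_norm h_gt0) ger0_norm // [K / _]mulrC.
by apply: lerD; rewrite ler_wpM2l // ltW.
Qed.

(** Serves for the values of the correction, its derivative and its Taylor remainder. *)
Lemma norm2_correction (u v : V) K K' : norm2 u <= K -> norm2 v <= K' ->
  norm2 (h^-1 *: (u + (1 - b)^-1 *: v)) <= (K + K' / (1 - b)) / h.
Proof.
move=> uK vK; rewrite norm2Z gtr0_norm ?invr_gt0 // mulrC ler_wpM2r //.
  by rewrite invr_ge0 ltW.
apply: le_trans (norm2D _ _) _; rewrite norm2Z ger0_norm // [K' / _]mulrC.
by apply: lerD => //; rewrite ler_wpM2l.
Qed.

Lemma correction_taylor lam lam' phi x A A' :
  taylor_at lam phi x A -> taylor_at lam' F x A' ->
  taylor_at ((lam + lam' / (1 - b)) / h) (correction phi) x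
    (h^-1 *: (A + (1 - b)^-1 *: A')).
Proof.
move=> phiA FA u.
have -> : correction phi (x + u) - correction phi x
    - u *m (h^-1 *: (A + (1 - b)^-1 *: A')) =
  h^-1 *: ((phi (x + u) - phi x - u *m A)
           + (1 - b)^-1 *: (F (x + u) - F x - u *m A')).
  rewrite /correction -scalemxAr mulmxDr -scalemxAr.
  set p := phi (x + u); set q := F (x + u).
  by apply/rowP => i; rewrite !mxE; ring.
apply: le_trans (norm2_correction (phiA u) (FA u)) _.
by rewrite le_eqVlt; apply/orP; left; apply/eqP; field; rewrite h_neq0.
Qed.

End VelocityGraph.

(** [zeta] is the position after one step from the graph, and the two sides of [gh_eq] are the graph
    value there and the new velocity. *)
Lemma gh_eqP (R : realType) d (L : 'rV[R]_d -> R) (b h : R) g : b < 1 ->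
  gh_eq L b h g <->
  forall x, velocity (grad L) b h g (x + h *: kick (grad L) b (velocity (grad L) b h g) x)
    = kick (grad L) b (velocity (grad L) b h g) x.
Proof.
move=> b1; rewrite /gh_eq /zeta; move: (grad L) => F.
have E x : velocity F b h g x = - (1 - b)^-1 *: F x + h *: g x.
  by rewrite /velocity addrC scaleNr.
by split=> H x; have := H x; rewrite E velocity_zeta // velocity_kick.
Qed.

(** * Choice of constants and return to the original unknown *)

Theorem mainTheorem1 (R : realType) (d : nat) (beta : R)
  (hbeta : 0 < beta < 1) (L : 'rV[R]_d -> R) (D1 D2 D3c D4 : R)
  (hL : C3 L)
  (hD1 : forall x, norm2 (grad L x) <= D1)
  (hD2 : forall x u, norm2 (u *m hess L x) <= D2 * norm2 u)
  (hD3 : forall x u v w, `|D3 L x u v w| <= D3c * norm2 u * norm2 v * norm2 w)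
  (hD4 : forall x y u v w,
     `|D3 L x u v w - D3 L y u v w| <= D4 * norm2 (x - y) * norm2 u * norm2 v * norm2 w) :
  exists h0 : R, 0 < h0 /\
  forall h : R, 0 < h < h0 ->
  exists gam del lam : R, [/\ 0 < gam, 0 < del, 0 < lam &
    exists g : 'rV[R]_d -> 'rV[R]_d,
      [/\ Gamma gam del lam g,
          gh_eq L beta h g,
          (forall g' : 'rV[R]_d -> 'rV[R]_d,
             Gamma gam del lam g' -> gh_eq L beta h g' -> g' = g) &
          forall theta v : nat -> 'rV[R]_d, HB_traj L beta h theta v ->
          forall n : nat,
            norm2 (v n + (1 - beta)^-1 *: grad L (theta n) - h *: g (theta n))
            <= (beta + h ^+ 2 * beta * del) ^+ n
               * norm2 (v 0%N + (1 - beta)^-1 *: grad L (theta 0%N) - h *: g (theta 0%N))]].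
Proof.
case: hL => dL dG dH _; have /andP[b0 b1] := hbeta.
have ob : 0 < 1 - beta by rewrite subr_gt0.
have ob0 : 1 - beta != 0 by rewrite gt_eqF.
(* For [d = 0] the hypotheses allow negative [D2] and [D3c]. *)
set d2 := `|D2|; set d3 := `|D3c|.
have d2_ge0 : 0 <= d2 := normr_ge0 D2; have d3_ge0 : 0 <= d3 := normr_ge0 D3c.
have G_lip : lipschitz2 d2 (grad L).
  apply: jac_bound_lipschitz => // x u; apply: le_trans (hD2 x u) _.
  by rewrite ler_wpM2r ?norm2_ge0 // ler_norm.
have [NF [G_taylor NF_sym]] : exists NF : 'rV[R]_d -> 'M[R]_d,
    (forall x, taylor_at d3 (grad L) x (NF x)) /\ (forall x, (NF x)^T = NF x).
  have G_taylor x : taylor_at d3 (grad L) x (hess L x)^T.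
    apply: grad_taylor => // y u v w; apply: le_trans (hD3 y u v w) _.
    by rewrite !ler_wpM2r ?norm2_ge0 // ler_norm.
  exists (fun x => (hess L x)^T); split => // x.
  exact: grad_taylor_sym d3_ge0 dL (G_taylor x).
have D1_ge0 : 0 <= D1 := le_trans (norm2_ge0 _) (hD1 0).
have gh_eqP' := gh_eqP L _ _ b1.
have G_traj h theta v : HB_traj L beta h theta v ->
    forall n, theta n.+1 = theta n - h *: grad L (theta n) + (h * beta) *: v n
      /\ v n.+1 = beta *: v n - grad L (theta n) by [].
move: (grad L) hD1 G_lip G_taylor gh_eqP' G_traj.
move=> F F_bound F_lip F_taylor ghP traj {dL dG dH hD2 hD3 hD4}.
(* Chosen for [d2_le]; the [+ 1] keeps [M] positive when [d2 = 0]. The threshold on [h] below is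
   exactly [hM_lt]. *)
pose M := 2 * (d2 / (1 - beta)) + 1.
have c_d2 : 0 <= d2 / (1 - beta) by rewrite divr_ge0 // ltW.
have M_gt0 : 0 < M by rewrite /M; lra.
have d2_le : 2 * d2 <= (1 - beta) * M.
  have : d2 = (1 - beta) * (d2 / (1 - beta)) by rewrite mulrC divfK.
  by rewrite /M; lra.
exists ((1 - beta) / (8 * M)); split; first by rewrite divr_gt0 // mulr_gt0.
move=> h /andP[h_gt0 h_lt].
have hM_lt : 8 * (h * M) < 1 - beta.
  by move: h_lt; rewrite ltr_pdivlMr ?mulr_gt0 //; lra.
pose lam := 8 * (d3 / (1 - beta)) + 1.
have c_d3 : 0 <= d3 / (1 - beta) by rewrite divr_ge0 // ltW.
have lam_ge : 8 * d3 <= (1 - beta) * lam.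
  have : d3 = (1 - beta) * (d3 / (1 - beta)) by rewrite mulrC divfK.
  by rewrite /lam; lra.
have [phi [N [phiE phi_lip phi_bound phi_taylor N_sym]]] :=
  invariant_graph hbeta h_gt0 d2_ge0 d3_ge0 F_bound F_lip F_taylor NF_sym
    M_gt0 d2_le hM_lt lam_ge.
have phi_fwd := graph_step_forward hbeta h_gt0 M_gt0 hM_lt phiE phi_lip.
(* Each constant adds the contributions of [phi] and of [F / (1 - beta)], divided by [h] as in
   [correction]; the [+ 1] in [gam] ensures positivity. *)
pose gam := (2 * (D1 / (1 - beta)) + 1) / h.
pose del := (M + d2 / (1 - beta)) / h.
pose lamT := (lam + d3 / (1 - beta)) / h.
have c_D1 : 0 <= D1 / (1 - beta) by rewrite divr_ge0 // ltW.
have h_gam : h * gam = 2 * (D1 / (1 - beta)) + 1 by rewrite mulrC divfK // gt_eqF.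
have h_del : h * del = M + d2 / (1 - beta) by rewrite mulrC divfK // gt_eqF.
have del_gt0 : 0 < del by rewrite divr_gt0 // ltr_pwDl.
have lamT_gt0 : 0 < lamT by rewrite divr_gt0 // /lam; lra.
have gam_gt0 : 0 < gam by rewrite divr_gt0 // ltr_wpDl // mulr_ge0.
exists gam, del, (6 * lamT); split => //; first exact: mulr_gt0.
pose g := correction F beta h phi.
have gK : velocity F beta h g = phi by exact: correctionK.
pose Ng x := h^-1 *: (N x + (1 - beta)^-1 *: NF x).
have g_taylor x : taylor_at lamT g x (Ng x).
  exact: (correction_taylor b1 h_gt0 (phi_taylor x) (F_taylor x)).
have Ng_sym x : (Ng x)^T = Ng x by rewrite /Ng linearZ linearD linearZ /= N_sym NF_sym.
have jacE x : jac g x = Ng x by rewrite (taylor_at_diff (g_taylor x)).2 Ng_sym.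
have jac_lip := taylor_lipschitz g_taylor.
exists g; split.
- split.
  + split=> [x|]; first exact: (taylor_at_diff (g_taylor x)).1.
    rewrite (_ : jac g = Ng); last exact/funext.
    exact: lipschitz_mx_continuous jac_lip.
  + move=> x; apply: le_trans (norm2_correction b1 h_gt0 (phi_bound x) (F_bound x)) _.
    by rewrite ler_wpM2r ?invr_ge0 ?(ltW h_gt0) //; lra.
  + move=> x u; rewrite jacE -scalemxAr mulmxDr -scalemxAr.
    apply: le_trans (norm2_correction b1 h_gt0 (taylor_at_bound phi_lip (phi_taylor x) u)
                       (taylor_at_bound F_lip (F_taylor x) u)) _.
    by rewrite le_eqVlt; apply/orP; left; apply/eqP; rewrite /del; ring.
  + by move=> x; rewrite jacE Ng_sym.
  + by move=> x y u; rewrite !jacE.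
- by apply/ghP; rewrite gK.
- move=> g' [[dg' _] g'_bound g'_jac _ _] /ghP g'E.
  have g'_lip : lipschitz2 del g'.
    exact: jac_bound_lipschitz (ltW del_gt0) dg' g'_jac.
  rewrite -(velocityK F beta h_gt0 g'); congr correction.
  (* Lipschitz constant of the velocity of any competitor. The choice of [M] gives [K <= 2 * M], so
     [h * (beta * K + d2) <= 3 * (h * M) < 1]. *)
  pose K := h * del + d2 / (1 - beta).
  apply: (@invariant_graph_unique _ _ F beta h d2 M hbeta h_gt0 d2_ge0 F_lip
           M_gt0 d2_le hM_lt phi _ K (h * gam + D1 / (1 - beta))) => //.
  + by move=> x; apply: le_trans (phi_bound x) _; rewrite h_gam; lra.
  + by rewrite /K h_del; lra.
  + rewrite /K h_del.
    have K_le : beta * (M + d2 / (1 - beta) + d2 / (1 - beta)) <= 2 * M.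
      have K2 : M + d2 / (1 - beta) + d2 / (1 - beta) <= 2 * M by rewrite /M; lra.
      apply: le_trans (_ : 1 * (M + d2 / (1 - beta) + d2 / (1 - beta)) <= _).
        by rewrite ler_wpM2r ?(ltW b1) //; lra.
      by rewrite mul1r.
    have d2M : d2 <= M by move: d2_le M_gt0 b0 d2_ge0; nra.
    have : h * (beta * (M + d2 / (1 - beta) + d2 / (1 - beta)) + d2) <= h * (3 * M).
      by rewrite ler_wpM2l ?(ltW h_gt0) //; lra.
    by move: hM_lt b0 (mulr_gt0 h_gt0 M_gt0); lra.
  + exact: velocity_lip.
  + by move=> x; exact: velocity_bound.
- move=> theta v /traj tr n.
  have E k : v k + (1 - beta)^-1 *: F (theta k) - h *: g (theta k) = v k - phi (theta k).
    by rewrite -gK /velocity opprB addrA.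
  rewrite !E.
  (* The rate obtained is [beta + h * beta * M], and [M <= h * del]. *)
  apply: le_trans (invariant_graph_attracts hbeta h_gt0 (ltW M_gt0) phi_lip phi_fwd tr n) _.
  rewrite ler_wpM2r ?norm2_ge0 // lerXn2r ?nnegrE //.
  + by rewrite addr_ge0 ?mulr_ge0 ?(ltW b0) ?(ltW h_gt0) ?(ltW M_gt0).
  + exact: addr_ge0 (ltW b0) (mulr_ge0 (mulr_ge0 (sqr_ge0 h) (ltW b0)) (ltW del_gt0)).
  rewrite lerD2l.
  have -> : h ^+ 2 * beta * del = h * beta * (h * del) by ring.
  by rewrite h_del ler_wpM2l ?lerDl // mulr_ge0 // ltW.
Qed.
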